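(* Let $q$ be a prime power and let $\mathcal{C}$ be an $[n,k]$ linear code over $\mathbb{F}_q$ with diameter $\delta$ and $d(\mathcal{C}^\perp)\geq 2$. Then $$\delta\geq \left\lceil \frac{n}{1+\frac{1}{q}+\cdots+\frac{1}{q^{k-1}}}\right\rceil,$$ that is, $$\delta\geq \left\lceil \frac{nq^{k-1}(q-1)}{q^{k}-1}\right\rceil.$$
   Context: An $[n,k]$ linear code over $\mathbb{F}_q$ (with $n$ a positive integer) is a $k$-dimensional $\mathbb{F}_q$-subspace $\mathcal{C}$ of $\mathbb{F}_q^n$. The Hamming weight $\mathrm{wt}(\mathbf{c})$ is the number of nonzero coordinates of $\mathbf{c}$. The diameter of $\mathcal{C}$ is its maximum weight, $\delta=\delta(\mathcal{C})=\max\{\mathrm{wt}(\mathbf{c}) : \mathbf{c}\in\mathcal{C}\}$. The dual code is $\mathcal{C}^\perp=\{\mathbf{x}\in\mathbb{F}_q^n : \sum_{i}x_ic_i=0 \text{ for all } \mathbf{c}\in\mathcal{C}\}$. The condition $d(\mathcal{C}^\perp)\ge 2$ means that $\mathcal{C}^\perp$ contains no vector of weight $1$; equivalently, a generator matrix of $\mathcal{C}$ (a $k\times n$ matrix whose rows form a basis of $\mathcal{C}$) has no zero column. *)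

(* Defs.v *)
From HB Require Import structures.
From mathcomp Require Import all_boot all_order all_algebra all_field.

Set Implicit Arguments.
Unset Strict Implicit.
Unset Printing Implicit Defensive.

Import Order.TTheory GRing.Theory Num.Theory.
Local Open Scope ring_scope.

Definition wt (F : finFieldType) (n : nat) (c : 'rV[F]_n) : nat :=
  #|[set i : 'I_n | c 0 i != 0]|.

Definition diameter (F : finFieldType) (n : nat) (C : {vspace 'rV[F]_n}) : nat :=
  \max_(c : 'rV[F]_n | c \in C) wt c.

Definition dual_code (F : finFieldType) (n : nat) (C : {vspace 'rV[F]_n}) :
    {set 'rV[F]_n} :=
  [set x : 'rV[F]_n |
    [forall c : 'rV[F]_n, (c \in C) ==> (\sum_(i < n) x 0 i * c 0 i == 0)]].

(* d(D) >= 2, with the convention that the zero code, which has no nonzero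
   word, satisfies it. *)
Definition min_dist_ge2 (F : finFieldType) (n : nat) (D : {set 'rV[F]_n}) : Prop :=
  forall x : 'rV[F]_n, x \in D -> wt x <> 1%N.

(* Main.v *)
(* Average the weight over the nonzero words. Since d(C^perp) >= 2, every
   coordinate is a nonzero functional on C, so it takes each value of F equally
   often and is nonzero on q^k - q^(k-1) words. Hence the total weight is
   n (q^k - q^(k-1)); it is at most (q^k - 1) delta, as the zero word does not
   contribute. *)

Require Import Defs.
From HB Require Import structures.
From mathcomp Require Import all_boot all_order all_algebra all_field.
From mathcomp Require Import ring.

Set Implicit Arguments.
Unset Strict Implicit.
Unset Printing Implicit Defensive.

Import Order.TTheory GRing.Theory Num.Theory.
Local Open Scope ring_scope.

Section Codes.

Variables (F : finFieldType) (n : nat) (C : {vspace 'rV[F]_n}).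

(** Otherwise the unit vector [delta_mx 0 i] would be a word of weight 1 in the dual. *)
Lemma dual_min_dist_ge2_coord (i : 'I_n) :
  min_dist_ge2 (dual_code C) -> exists2 c : 'rV[F]_n, c \in C & c 0 i != 0.
Proof.
move=> hdual.
have [c /andP[cC ci]|allz] :=
  pickP [pred c : 'rV[F]_n | (c \in C) && (c 0 i != 0)].
  by exists c.
case: (hdual (delta_mx 0 i)); last first.
  rewrite /wt (_ : [set _ | _] = [set i]) ?cards1 //.
  by apply/setP=> j; rewrite !inE mxE eqxx; case: (j == i); rewrite ?oner_eq0 ?eqxx.
rewrite inE; apply/forallP=> c; apply/implyP=> cC.
rewrite (bigD1 i) //= big1 => [|j ji]; last by rewrite mxE eqxx (negPf ji) mul0r.
by rewrite mxE !eqxx mul1r addr0; have := allz c; rewrite /= cC => /negbFE.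
Qed.

(** Translation by the multiple of [c0] whose coordinate [i] is [a] maps the zero fibre bijectively
    onto the fibre over [a]. *)
Lemma card_coord_fibre (i : 'I_n) (c0 : 'rV[F]_n) (a : F) :
    c0 \in C -> c0 0 i != 0 ->
  #|[set c in C | c 0 i == a]| = #|[set c in C | c 0 i == 0]|.
Proof.
move=> c0C c0i; pose t := (a / c0 0 i) *: c0.
have tC : t \in C by rewrite memvZ.
have ti : t 0 i = a by rewrite mxE divfK.
rewrite -(card_imset [set c in C | c 0 i == 0] (addIr t)); apply: eq_card => c.
rewrite !inE; apply/andP/imsetP => [[cC /eqP ci]|[d]].
  by exists (c - t); rewrite ?subrK // inE rpredB //= mxE ci mxE ti subrr eqxx.
by rewrite inE => /andP[dC /eqP di] ->; rewrite rpredD // mxE di ti add0r.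
Qed.

(** The fibres over the elements of [F] have equal size, so each is a fraction 1/q of [C]. The
    factor [#|F|] on the left avoids the exponent k - 1 in [nat]. *)
Lemma card_coord_neq0 (i : 'I_n) (c0 : 'rV[F]_n) :
    c0 \in C -> c0 0 i != 0 ->
  (#|F| * #|[set c in C | c 0%R i != 0%R]| = #|F| ^ \dim C * #|F|.-1)%N.
Proof.
move=> c0C c0i; set Z := #|[set c in C | c 0 i == 0]|.
have cardC : (#|F| ^ \dim C = #|F| * Z)%N.
  rewrite -card_vspace -sum1_card.
  rewrite (partition_big (fun c : 'rV[F]_n => c 0 i) predT) //=.
  rewrite (eq_bigr (fun=> Z)) ?sum_nat_const // => a _.
  rewrite /Z -(card_coord_fibre a c0C c0i) -sum1_card.
  by apply: eq_bigl => c; rewrite inE.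
have splitC : (#|F| ^ \dim C = Z + #|[set c in C | c 0%R i != 0%R]|)%N.
  rewrite -card_vspace -(cardID [pred c : 'rV[F]_n | c 0 i == 0] (mem C)).
  by congr (_ + _)%N; apply: eq_card => c; rewrite !inE // andbC.
have -> : #|[set c in C | c 0 i != 0]| = (#|F| ^ \dim C - Z)%N.
  by rewrite splitC addKn.
by rewrite mulnBr -cardC mulnC -subn1 mulnBr muln1.
Qed.

(** Double counting of the pairs (c, i) with c in [C] and nonzero coordinate i. *)
Lemma sum_wt :
  (\sum_(c in C) wt c = \sum_(i < n) #|[set c in C | c 0%R i != 0%R]|)%N.
Proof.
rewrite (eq_bigr (fun c : 'rV[F]_n => \sum_(i < n | c 0%R i != 0%R) 1)%N); last first.
  by move=> c _; rewrite /wt -sum1_card; apply: eq_bigl => i; rewrite inE.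
rewrite (exchange_big_dep predT) //=; apply: eq_bigr => i _.
by rewrite -sum1_card; apply: eq_bigl => c; rewrite inE.
Qed.

Lemma sum_wt_le : (\sum_(c in C) wt c <= (#|F| ^ \dim C).-1 * diameter C)%N.
Proof.
rewrite -card_vspace (cardD1 0) mem0v add1n /=.
rewrite (bigD1 0) ?mem0v //= {1}/wt (_ : [set _ | _] = set0) ?cards0 ?add0n; last first.
  by apply/setP=> i; rewrite !inE mxE eqxx.
rewrite -sum_nat_const [leqRHS](eq_bigl (fun c => (c \in C) && (c != 0))).
  by apply: leq_sum => c /andP[cC _]; apply: leq_bigmax_cond.
by move=> c; rewrite !inE andbC.
Qed.

Lemma length_diameter_bound : min_dist_ge2 (dual_code C) ->
  (n * (#|F| ^ \dim C * #|F|.-1) <= #|F| * ((#|F| ^ \dim C).-1 * diameter C))%N.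
Proof.
move=> hdual; apply: leq_trans (leq_mul (leqnn #|F|) sum_wt_le).
rewrite sum_wt big_distrr /= (eq_bigr (fun=> (#|F| ^ \dim C * #|F|.-1)%N)).
  by rewrite sum_nat_const card_ord.
move=> i _; have [c cC ci] := dual_min_dist_ge2_coord i hdual.
by apply: card_coord_neq0 cC ci.
Qed.

End Codes.

(* The case k = 0, where k.-1 and the denominators would be degenerate, is
   excluded by the hypotheses: the dual of the zero code is the whole space,
   which contains words of weight 1 since 0 < n. *)
Theorem corollary4p1 (F : finFieldType) (q n k : nat)
    (C : {vspace 'rV[F]_n})
    (hq : #|F| = q) (hn : (0 < n)%N) (hk : \dim C = k)
    (hdual : min_dist_ge2 (dual_code C)) :
  Num.ceil ((n%:R : rat) / (\sum_(i < k) (q%:R ^+ i)^-1))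
    <= (diameter C)%:Z
  /\
  Num.ceil ((n%:R * q%:R ^+ k.-1 * (q%:R - 1) : rat) / (q%:R ^+ k - 1))
    <= (diameter C)%:Z.
Proof.
have q_gt1 : (1 < q)%N by rewrite -hq card_finNzRing_gt1.
have k_gt0 : (0 < k)%N.
  have [c cC ci] := dual_min_dist_ge2_coord (Ordinal hn) hdual.
  rewrite -hk lt0n dimv_eq0; apply: contraNneq ci => C0.
  by move: cC; rewrite C0 memv0 => /eqP->; rewrite mxE.
have := length_diameter_bound hdual; rewrite hk hq => bound.
case: k {hk} k_gt0 bound => // m _ bound.
have qR_gt1 : 1 < q%:R :> rat by rewrite ltr1n.
have qR_gt0 : 0 < q%:R :> rat by apply: lt_trans qR_gt1.
have geom : \sum_(i < m.+1) (q%:R ^+ i)^-1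
    = (q%:R ^+ m.+1 - 1) / (q%:R ^+ m * (q%:R - 1)) :> rat.
  rewrite subrX1 [X in X / _]mulrC -mulf_div divff ?subr_eq0 ?gt_eqF // mulr1.
  (* With the inverse powers summed in reverse order, the two sides agree termwise: q^-(m-i) = q^i /
     q^m. *)
  rewrite mulr_suml (reindex_inj rev_ord_inj) /=; apply: eq_bigr => i _.
  have im : (i <= m)%N by rewrite -ltnS.
  have -> : q%:R ^+ m = q%:R ^+ (m - i) * q%:R ^+ i :> rat by rewrite -exprD subnK.
  by rewrite subSS invfM mulrCA divff ?mulr1 ?expf_neq0 ?gt_eqF.
have second :
    Num.ceil ((n%:R * q%:R ^+ m * (q%:R - 1) : rat) / (q%:R ^+ m.+1 - 1))
    <= (diameter C)%:Z.
  rewrite ceil_le_int ler_pdivrMr ?subr_gt0 ?exprn_egt1 // -(ler_pM2l qR_gt0).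
  move: bound; rewrite -(ler_nat rat) !natrM -!subn1 !natrB ?expn_gt0 ?(ltnW q_gt1) //.
  rewrite !natrX; congr (_ <= _); first by rewrite exprS; ring.
  by rewrite pmulrn; ring.
(* By [geom] both fractions are equal, so the first bound is the second one. *)
by split=> //; rewrite geom invf_div mulrA [n%:R * _]mulrA.
Qed.
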